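(* Let $\hat M$ be a simplification of the VCG sponsored search mechanism that is Vickrey-preserving on $\Psi$. Then for every $\theta\in\Psi$ and every $\epsilon>0$ there exists an efficient Nash equilibrium of $\hat M$ for $\theta$ with revenue at most $\epsilon$.
   Context: Sponsored search setting: agents $N=\{1,\dots,n\}$, slots $1,\dots,k$ with $k\le n$; an outcome assigns agents to distinct positions, position $j\le k$ meaning slot $j$, others getting nothing (value 0); utilities quasilinear. $\mathbb{R}^n_{>}$: vectors $\beta$ with $1=\beta_1>\dots>\beta_k>0$ and $\beta_j=0$ for $j>k$. $\Theta^\beta$: type profiles where agent $i$ has $v_i(\theta_i)\ge0$ and values slot $j$ at $\beta_j v_i(\theta_i)$; $\Psi=\bigcup_{\beta\in\mathbb{R}^n_{>}}\Theta^\beta$. VCG mechanism: each agent $i$ sends a message consisting of a bid $x_{i,j}$ for each slot $j$; an assignment maximizing total bids is chosen; agent $i$ pays the Clarke payment (max total bid of the others over all assignments minus others' total bid in the chosen assignment). The VCG outcome for $\theta$ is the result under truthful bids. A simplification $\hat M$ of VCG restricts each agent's message set to some subset $\hat X_i$ of bid vectors, keeping the VCG assignment and payment rule on the restricted messages. Vickrey-preserving on $\Psi$: for every $\theta\in\Psi$, $\hat M$ has a Nash equilibrium for $\theta$ yielding the VCG outcome for $\theta$. Nash equilibrium (complete information): no agent can strictly gain by unilateral deviation within $\hat X_i$; efficient: the assignment maximizes total true value. Revenue: sum of payments. *)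

(* Defs.v *)
From HB Require Import structures.
From mathcomp Require Import all_boot all_order all_algebra all_fingroup.
From mathcomp Require Import reals.
Set Implicit Arguments. Unset Strict Implicit. Unset Printing Implicit Defensive.
Import Order.TTheory GRing.Theory Num.Theory.
Local Open Scope ring_scope.

(* Agents are 'I_n, positions are 'I_n (0-indexed; position p < k is slot p,
   positions p >= k give nothing). An outcome assignment is a permutation
   sigma : {perm 'I_n} sending agent i to position sigma i.
   A message (bid vector) is  x : 'I_k -> R  (one bid per slot). *)

Section Sponsored.
Variable R : realType.
Variables n k : nat.

Definition bid := 'I_k -> R.
Definition profile := 'I_n -> bid.

Definition posbid (x : bid) (p : 'I_n) : R :=
  match @insub nat (fun m => m < k)%N 'I_k (nat_of_ord p) with
  | Some j => x j
  | None => 0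
  end.

Definition total_bid (m : profile) (s : {perm 'I_n}) : R :=
  \sum_(i < n) posbid (m i) (s i).

(* alloc is a VCG allocation rule: it always picks a bid-maximizing assignment
   (the tie-breaking rule is arbitrary). *)
Definition maximizing_rule (alloc : profile -> {perm 'I_n}) : Prop :=
  forall m s, total_bid m s <= total_bid m (alloc m).

Definition others_bid (m : profile) (i : 'I_n) (s : {perm 'I_n}) : R :=
  \sum_(l < n | l != i) posbid (m l) (s l).

Definition clarke_pay (alloc : profile -> {perm 'I_n}) (m : profile) (i : 'I_n) : R :=
  \big[Num.max/others_bid m i 1%g]_(s : {perm 'I_n}) others_bid m i s
  - others_bid m i (alloc m).

Definition revenue (alloc : profile -> {perm 'I_n}) (m : profile) : R := \sum_(i < n) clarke_pay alloc m i.

(* type profiles: th i p = value of agent i for position p *)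
Definition valuation := 'I_n -> 'I_n -> R.

Definition beta_ok (beta : 'I_n -> R) : Prop :=
  (forall p : 'I_n, nat_of_ord p = 0%N -> beta p = 1) /\
  (forall p : 'I_n, (p < k)%N -> 0 < beta p) /\
  (forall p q : 'I_n, (p < q)%N -> (q < k)%N -> beta q < beta p) /\
  (forall p : 'I_n, (k <= p)%N -> beta p = 0).

Definition in_Psi (th : valuation) : Prop :=
  exists beta : 'I_n -> R, exists v : 'I_n -> R,
    beta_ok beta /\ (forall i, 0 <= v i) /\ (forall i p, th i p = beta p * v i).

Definition truthful (hk : (k <= n)%N) (th : valuation) : profile :=
  fun i j => th i (widen_ord hk j).

Definition utility (alloc : profile -> {perm 'I_n}) (th : valuation) (m : profile) (i : 'I_n) : R :=
  th i (alloc m i) - clarke_pay alloc m i.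

Definition update (m : profile) (i : 'I_n) (x : bid) : profile :=
  fun l => if l == i then x else m l.

(* Nash equilibrium of the simplified mechanism with message sets Xh *)
Definition is_NE (alloc : profile -> {perm 'I_n}) (Xh : 'I_n -> bid -> Prop) (th : valuation) (m : profile) : Prop :=
  (forall i, Xh i (m i)) /\
  (forall i (x : bid), Xh i x -> utility alloc th (update m i x) i <= utility alloc th m i).

Definition efficient (th : valuation) (s : {perm 'I_n}) : Prop :=
  forall s' : {perm 'I_n}, \sum_(i < n) th i (s' i) <= \sum_(i < n) th i (s i).

Definition vickrey_preserving (hk : (k <= n)%N) (alloc : profile -> {perm 'I_n}) (Xh : 'I_n -> bid -> Prop) : Prop :=
  forall th, in_Psi th ->
    exists m, is_NE alloc Xh th m /\
      alloc m = alloc (truthful hk th) /\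
      (forall i, clarke_pay alloc m i = clarke_pay alloc (truthful hk th) i).

End Sponsored.

(* Main.v *)
Require Import Defs.
From HB Require Import structures.
From mathcomp Require Import all_boot all_order all_algebra all_fingroup.
From mathcomp Require Import reals.
From mathcomp Require Import lra.
Import Order.TTheory GRing.Theory Num.Theory.
Local Open Scope ring_scope.

(* Clarke payments are competitive prices for the reported bids: nobody would
   rather have another agent's position at that agent's payment. Hence the VCG
   payments bound bid differences in any equilibrium with the VCG outcome.

   Let sigma be the VCG assignment for theta. Applying Vickrey preservation to
   types whose weights are almost flat down to slot j and then drop sharply, the
   agent in slot j has a message bidding almost as much for j as for any better
   slot, but hugely more for j than for any worse one. Applying it to a tiny
   multiple of theta, agents with value 0 under sigma have messages that barely
   favour any other position, and favour none among the positions of such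
   agents. Give every agent of positive value under sigma (a winner) the first
   kind of message, every other agent the second. The chosen assignment then
   keeps all winners in place, since one of them would otherwise move down; all
   payments are tiny; deviating to a better slot is prohibitively expensive, and
   to a worse one saves less than it loses. *)

(** * Exchange arguments for optimal assignments *)

Lemma perm_glue {T : finType} (D : {set T}) (s t : {perm T}) :
  t @: D = s @: D ->
  exists u : {perm T}, forall x, u x = if x \in D then t x else s x.
Proof.
move=> imE.
have cross x y : x \in D -> y \notin D -> t x <> s y.
  move=> xD yD e; have : t x \in s @: D by rewrite -imE imset_f.
  by rewrite e mem_imset ?(negPf yD) //; exact: perm_inj.
have inj_u : injective (fun x => if x \in D then t x else s x).
  move=> x y; case: (boolP (x \in D)) => xD; case: (boolP (y \in D)) => yD e.
  - exact: perm_inj e.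
  - by case: (cross x y).
  - by case: (cross y x).
  - exact: perm_inj e.
by exists (perm inj_u) => x; rewrite permE.
Qed.

Lemma perm_imset_eq {T : finType} (D : {set T}) (s t : {perm T}) :
  (forall x, x \in D -> exists2 z, z \in D & t x = s z) -> t @: D = s @: D.
Proof.
move=> tD; apply/eqP; rewrite eqEcard !card_imset ?leqnn ?andbT; try exact: perm_inj.
by apply/subsetP => _ /imsetP[x /tD[z zD ->] ->]; apply: imset_f.
Qed.

(** Gluing [t] on [D] to [s] elsewhere gives a permutation, so optimality of [s] holds already on
    [D]. Off [D], [a] and [b] need only agree, not come from [s]. *)
Lemma max_perm_le_on {R : realType} {T : finType} (y : T -> T -> R)
    (s t : {perm T}) (D : {set T}) (a b : T -> R) :
  (forall u : {perm T}, \sum_x y x (u x) <= \sum_x y x (s x)) ->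
  t @: D = s @: D ->
  (forall x, x \in D -> a x = y x (t x)) ->
  (forall x, x \in D -> b x = y x (s x)) ->
  (forall x, x \notin D -> a x = b x) ->
  \sum_x a x <= \sum_x b x.
Proof.
move=> s_max /perm_glue[u uE] aD bD abD; have := s_max u.
rewrite (bigID (mem D)) [leRHS](bigID (mem D)) /=.
rewrite [X in _ + X](eq_bigr (fun x => y x (s x))); last first.
  by move=> x xD; rewrite uE (negPf xD).
rewrite lerD2r => le_D.
rewrite (bigID (mem D)) [leRHS](bigID (mem D)) /= (eq_bigr _ abD) lerD2r.
rewrite (eq_bigr _ aD) (eq_bigr _ bD).
by rewrite (eq_bigr (fun x => y x (u x))) // => x xD; rewrite uE xD.
Qed.

(* Symmetric-difference argument on two assignments: follow [l] along
   [f := t * s^-1]. If its orbit avoids [i], exchange [s] and [t] on the whole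
   orbit; otherwise only on the arc from [l] to the first visit of [i]. *)
Lemma assignment_exchange {R : realType} {T : finType} (y : T -> T -> R)
    (s t : {perm T}) (i l : T) :
  (forall u : {perm T}, \sum_x y x (u x) <= \sum_x y x (s x)) -> i != l ->
  exists u : {perm T},
    \sum_(x | x != i) y x (t x) + y i (s l)
      <= \sum_(x | x != l) y x (u x) + y l (s l).
Proof.
move=> s_max neq_il; pose f : {perm T} := (t * s^-1)%g.
have sf x : s (f x) = t x by rewrite /f permM permKV.
(* Each side is completed to a sum over all agents, with the special agent at [s l], so that only
   terms in the exchange set differ. *)
pose a x := if x == i then y i (s l) else y x (t x).
pose b (u : {perm T}) x := if x == l then y l (s l) else y x (u x).
suff [u le_ab] : exists u, \sum_x a x <= \sum_x b u x.
  exists u; move: le_ab; rewrite (bigD1 i) //= [leRHS](bigD1 l) //=.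
  rewrite /a /b !eqxx addrC [leRHS]addrC.
  rewrite (eq_bigr (fun x => y x (t x))); last by move=> x /negPf->.
  by rewrite [X in _ <= X + _](eq_bigr (fun x => y x (u x))) // => x /negPf->.
have [iD|iD] := boolP (i \in porbit f l); last first.
  pose D := porbit f l; have lD : l \in D by exact: porbit_id.
  have imE : t @: D = s @: D.
    apply: perm_imset_eq => x xD; exists (f x); last by rewrite sf.
    by move: xD; rewrite /D -eq_porbit_mem => /eqP <-; rewrite (mem_porbit f 1).
  have [w wE] := perm_glue _ _ _ (esym imE).
  (* The transposition hands [s l] to [i]; [l], whose own term is excluded, takes [t i]. *)
  exists (w * tperm (s l) (t i))%g.
  apply: (max_perm_le_on _ _ _ _ _ _ s_max imE).
  - by move=> x xD; rewrite /a; case: eqP => // xi; rewrite -xi xD in iD.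
  - move=> x xD; rewrite /b; case: eqP => [->//|/eqP xl].
    rewrite permM wE xD tpermD //; first by rewrite (inj_eq perm_inj) eq_sym.
    apply/eqP => tx; have : t i \in t @: D by rewrite imE tx imset_f.
    by rewrite mem_imset ?(negPf iD) //; exact: perm_inj.
  - move=> x xD; rewrite /a /b.
    have /negPf -> : x != l by apply: contraNneq xD => ->.
    rewrite permM wE (negPf xD); case: eqP => [->|/eqP xi].
      by rewrite tpermR.
    rewrite tpermD ?(inj_eq perm_inj) 1?eq_sym //.
    apply: contraNneq xD => e; have : s l \in t @: D by rewrite imE imset_f.
    by rewrite -e mem_imset //; exact: perm_inj.
have : exists r, (f ^+ r)%g l == i.
  by have /porbitP[r ->] := iD; exists r.
case/ex_minnP => r /eqP fr r_min.
have r_lt p : (p < r)%N -> (f ^+ p)%g l != i.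
  by move=> pr; apply/negP => /r_min; rewrite leqNgt pr.
(* A return to [l] before reaching [i] would give an earlier visit of [i]. *)
have no_ret p : (0 < p <= r)%N -> (f ^+ p)%g l != l.
  case/andP=> p0 pr; apply/eqP => fp.
  have /eqP[] : (f ^+ (r - p))%g l != i by apply: r_lt; rewrite ltn_subrL p0 (leq_trans p0).
  by rewrite -fr -{2}(subnK pr) addnC expgD permM fp.
pose D := [set (f ^+ nat_of_ord p)%g l | p : 'I_r.+1].
have inD p : (p <= r)%N -> (f ^+ p)%g l \in D.
  by move=> pr; apply/imsetP; exists (inord p); rewrite // inordK.
have lD : l \in D by rewrite (_ : l = (f ^+ 0)%g l) ?inD // expg0 perm1.
have fl x : x \in D -> x != i -> (t x != s l) /\ f x \in D.
  case/imsetP => -[p /= pr] _ -> xi; rewrite -sf (inj_eq perm_inj).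
  have {}pr : (p < r)%N.
    by rewrite ltn_neqAle -ltnS pr andbT; apply: contraNneq xi => ->; rewrite fr.
  by rewrite -permM -expgSr; split; [apply: no_ret | apply: inD].
(* Sending [i] to [s l] closes the arc: [t'] and [s] then have the same image on [D]. *)
pose t' := (t * tperm (s l) (t i))%g.
have t'D x : x \in D -> x != i -> t' x = t x.
  move=> xD xi; have [tl _] := fl x xD xi; rewrite permM tpermD // 1?eq_sym //.
  by rewrite (inj_eq perm_inj).
have t'i : t' i = s l by rewrite permM tpermR.
have imE : t' @: D = s @: D.
  apply: perm_imset_eq => x xD; have [->|xi] := eqVneq x i; first by exists l.
  by exists (f x); [have [] := fl x xD xi | rewrite sf t'D].
have [w wE] := perm_glue _ _ _ (esym imE).
exists (w * tperm (s l) (t i))%g.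
apply: (max_perm_le_on _ _ _ _ _ _ s_max imE).
- by move=> x xD; rewrite /a; case: eqP => [->|/eqP xi]; rewrite ?t'i ?t'D.
- move=> x xD; rewrite /b; case: eqP => [->//|/eqP xl].
  rewrite permM wE xD tpermD //; first by rewrite (inj_eq perm_inj) eq_sym.
  apply/eqP => tx; have : s x \in t' @: D by rewrite imE imset_f.
  case/imsetP => z zD; have [->|zi] := eqVneq z i.
    by rewrite t'i => /perm_inj /eqP; rewrite (negPf xl).
  by rewrite t'D // -tx => /perm_inj /eqP; rewrite eq_sym (negPf zi).
- move=> x xD; rewrite /a /b.
  have /negPf -> : x != l by apply: contraNneq xD => ->.
  have /negPf -> : x != i by apply: contraNneq xD => ->; rewrite -fr inD.
  by rewrite permM wE (negPf xD) permM tpermK.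
Qed.

(** * Clarke payments as envy-free prices *)

Section Clarke.
Context {R : realType} {n k : nat}.
Implicit Types (alloc : profile R n k -> {perm 'I_n}) (m : profile R n k).

Lemma clarke_pay_ge alloc m i s :
  others_bid m i s - others_bid m i (alloc m) <= clarke_pay alloc m i.
Proof. by rewrite lerD2r; apply: le_bigmax. Qed.

Lemma clarke_pay_ge0 alloc m i : 0 <= clarke_pay alloc m i.
Proof. by rewrite -(subrr (others_bid m i (alloc m))) clarke_pay_ge. Qed.

Lemma clarke_pay_le alloc m i c :
  (forall s, others_bid m i s <= others_bid m i (alloc m) + c) ->
  clarke_pay alloc m i <= c.
Proof. by move=> le_c; rewrite lerBlDl; apply: bigmax_le => *; apply: le_c. Qed.

Lemma total_bid_others m i s :
  total_bid m s = posbid (m i) (s i) + others_bid m i s.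
Proof. by rewrite /total_bid (bigD1 i). Qed.

(** By [assignment_exchange], any assignment competing in the payment of [i] yields one competing in
    that of [l], which bounds the former payment by the latter. *)
Lemma clarke_pay_no_envy alloc m i l : maximizing_rule alloc ->
  posbid (m i) (alloc m l) - posbid (m i) (alloc m i)
    <= clarke_pay alloc m l - clarke_pay alloc m i.
Proof.
move=> max_alloc; have [<-|neq_il] := eqVneq i l; first by rewrite !subrr.
rewrite lerBrDl -lerBrDr; apply: clarke_pay_le => t.
have [u] := assignment_exchange (fun x => posbid (m x)) _ t i l (max_alloc m) neq_il.
rewrite -/(others_bid m i t) -/(others_bid m l u).
have := clarke_pay_ge alloc m l u.
have := total_bid_others m i (alloc m); rewrite (total_bid_others m l) => e.
move: e; set A := others_bid m l _; set B := others_bid m i (alloc m) => *; lra.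
Qed.

End Clarke.

(** * Types in $\Psi$: efficient assignments, and weights with one sharp drop *)

Section Values.
Context {R : realType} {n k : nat}.
Variable hk : (k <= n)%N.
Implicit Types (th : valuation R n) (s : {perm 'I_n}).

Lemma posbid_truthful th i p : in_Psi k th -> posbid (truthful hk th i) p = th i p.
Proof.
case=> beta [v [[_ [_ [_ beta0]]] [_ thE]]]; rewrite /posbid.
case: insubP => [j _ jp|]; first by rewrite /truthful; congr th; apply: val_inj.
by rewrite -leqNgt => /beta0 b0; rewrite thE b0 mul0r.
Qed.

Lemma truthful_efficient th alloc : in_Psi k th -> maximizing_rule alloc ->
  efficient th (alloc (truthful hk th)).
Proof.
move=> thP max_alloc s; have := max_alloc (truthful hk th) s.
by rewrite /total_bid; under eq_bigr do rewrite posbid_truthful //;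
   under [leRHS]eq_bigr do rewrite posbid_truthful //.
Qed.

Lemma efficient_swap th s a b : efficient th s ->
  th a (s b) + th b (s a) <= th a (s a) + th b (s b).
Proof.
move=> eff; have [->//|ab] := eqVneq a b.
have := eff (tperm a b * s)%g.
have ba : b != a by rewrite eq_sym.
rewrite (bigD1 a) 1?(bigD1 b) //= [leRHS](bigD1 a) 1?[X in _ <= _ + X](bigD1 b) //=.
rewrite !permM tpermL tpermR !addrA.
rewrite (eq_bigr (fun x => th x (s x))) ?lerD2r // => x /andP[xa xb].
by rewrite permM tpermD // eq_sym.
Qed.

Lemma in_Psi_ge0 th i p : in_Psi k th -> 0 <= th i p.
Proof.
case=> beta [v [[_ [bpos [_ b0]]] [v0 ->]]]; apply: mulr_ge0 => //.
by case: (ltnP p k) => [/bpos/ltW|/b0->].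
Qed.

Lemma in_Psi_scale th (c : R) : 0 <= c -> in_Psi k th ->
  in_Psi k (fun i p => c * th i p).
Proof.
move=> c0 [beta [v [bok [v0 thE]]]]; exists beta, (fun i => c * v i).
by split=> //; split=> [i|i p]; [apply: mulr_ge0 | rewrite thE mulrCA].
Qed.

(** Strong induction on the slot: better slots are already taken by their own agents, and if [a]
    were lower, swapping it with the occupant of [sg a], whose [v] is smaller, would gain. *)
Lemma efficient_sorted th beta v s (sg : {perm 'I_n}) a :
  beta_ok k beta -> (forall i p, th i p = beta p * v i) ->
  (forall a b, (sg a < sg b)%N -> v b < v a) -> efficient th s ->
  (sg a < k)%N -> s a = sg a :> nat.
Proof.
move=> [_ [bpos [bdec b0]]] thE vdec eff; have [r] := ubnP (sg a).
elim: r a => // r IH a; rewrite ltnS => ar ak.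
have below p : (p < sg a)%N -> s a <> p :> nat.
  move=> pa sap; pose b := (sg^-1)%g (Ordinal (ltn_trans pa (ltn_ord _))).
  have sgb : sg b = p :> nat by rewrite permKV.
  have : s b = sg b :> nat
    by apply: IH; rewrite sgb; [exact: leq_trans pa ar | exact: ltn_trans pa ak].
  rewrite sgb -sap => /val_inj/perm_inj e.
  by have := pa; rewrite -{1}sgb e ltnn.
have [sa|sa|//] := ltngtP (s a) (sg a); first by case: (below (s a) sa).
pose b := (s^-1)%g (sg a); have sb : s b = sg a by rewrite permKV.
have sgab : (sg a < sg b)%N.
  rewrite ltnNge leq_eqVlt; apply/negP => /orP[/eqP/val_inj/perm_inj e|ba].
    by move: sa; rewrite -sb e ltnn.
  have : s b = sg b :> nat by apply: IH; [exact: leq_trans ba ar | exact: ltn_trans ba ak].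
  by rewrite sb => e; rewrite e ltnn in ba.
have vab := vdec _ _ sgab.
have bab : beta (s a) < beta (sg a).
  by case: (ltnP (s a) k) => [sk|/b0->]; [apply: bdec | apply: bpos].
have gain : 0 < (beta (sg a) - beta (s a)) * (v a - v b) by apply: mulr_gt0; rewrite subr_gt0.
by exfalso; have := efficient_swap _ _ a b eff; rewrite !thE sb; lra.
Qed.

(** If the holder of a better position derived nothing from it, swapping with [a] would raise total
    value. *)
Lemma winners_downset th s a (p : 'I_n) : in_Psi k th -> efficient th s ->
  0 < th a (s a) -> (p < s a)%N -> 0 < th ((s^-1)%g p) p.
Proof.
move=> thP eff tha pa; rewrite lt_neqAle in_Psi_ge0 // andbT eq_sym.
apply/eqP => thb; have := efficient_swap _ _ a ((s^-1)%g p) eff.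
rewrite permKV thb; case: thP tha => beta [v [[_ [bpos [bdec b0]]] [v0 thE]]].
rewrite !thE => tha.
have sk : (s a < k)%N.
  by rewrite ltnNge; apply/negP => /b0 e; move: tha; rewrite e mul0r ltxx.
have bs := bpos _ sk; have va : 0 < v a by rewrite -(pmulr_rgt0 _ bs).
have bp := bpos _ (ltn_trans pa sk).
have gain : 0 < (beta p - beta (s a)) * v a.
  by apply: mulr_gt0; rewrite // subr_gt0; apply: bdec.
have := mulr_ge0 (ltW bs) (v0 ((s^-1)%g p)); lra.
Qed.

End Values.

(* Weights that are nearly flat up to slot [j] and drop by at least 1/2 after it. *)
Definition step_weight {R : realType} {n} (k : nat) (j : 'I_n) (eta : R) (p : 'I_n) : R :=
  if (k <= p)%N then 0
  else if (p <= j)%N then 1 - p%:R * eta else (n%:R - p%:R) * eta.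

Section StepWeight.
Context {R : realType} {n k : nat}.
Variables (j : 'I_n) (eta : R).
Hypotheses (jk : (j < k)%N) (eta_gt0 : 0 < eta) (eta_small : n%:R * eta <= 1 / 4).

Let pn (p : 'I_n) :
  [/\ 0 <= p%:R * eta, p%:R * eta < n%:R * eta & n%:R * eta <= 1 / 4].
Proof. by split=> //; [rewrite mulr_ge0 // ltW | rewrite ltr_pM2r // ltr_nat]. Qed.

Lemma step_weight_ok : beta_ok k (step_weight k j eta).
Proof.
rewrite /step_weight; split=> [p p0|].
  by rewrite p0 mul0r subr0 leqNgt (leq_ltn_trans (leq0n j) jk).
split=> [p pk|].
  by rewrite leqNgt pk /=; have [P0 P1 N4] := pn p; case: ifP => _; lra.
split=> [p q pq qk|p ->//].
rewrite [(k <= q)%N]leqNgt qk [(k <= p)%N]leqNgt (ltn_trans pq qk) /=.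
have [P0 P1 N4] := pn p; have [Q0 Q1 _] := pn q.
have PQ : p%:R * eta < q%:R * eta by rewrite ltr_pM2r // ltr_nat.
have [qj|qj] := leqP q j; first by rewrite (leq_trans (ltnW pq) qj); lra.
by case: ifP => _; lra.
Qed.

(** Up to slot [j] the weights exceed 3/4; after it they are at most [n%:R * eta], hence at most
    1/4. *)
Lemma step_weight_drop (q : 'I_n) : (j < q)%N ->
  step_weight k j eta q - step_weight k j eta j <= - (1 / 2).
Proof.
move=> jq; rewrite /step_weight [(k <= j)%N]leqNgt jk /= leqnn [(q <= j)%N]leqNgt jq /=.
by have [J0 J1 N4] := pn j; have [Q0 Q1 _] := pn q; case: ifP => _; lra.
Qed.

Lemma step_weight_flat (q : 'I_n) : (q <= j)%N ->
  step_weight k j eta q - step_weight k j eta j <= n%:R * eta.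
Proof.
move=> qj; rewrite /step_weight [(k <= q)%N]leqNgt (leq_ltn_trans qj jk) [(k <= j)%N]leqNgt jk /=.
rewrite leqnn qj.
have [J0 J1 N4] := pn j; have [Q0 Q1 _] := pn q; lra.
Qed.

End StepWeight.

(** * Messages guaranteed by Vickrey preservation *)

Section Messages.
Context {R : realType} {n k : nat}.
Variables (hk : (k <= n)%N) (alloc : profile R n k -> {perm 'I_n}).
Hypothesis max_alloc : maximizing_rule alloc.
Variable Xh : 'I_n -> bid R k -> Prop.
Hypothesis HV : vickrey_preserving hk alloc Xh.

(* Both profiles are supported by the same prices. *)
Lemma preserving_bid_diff th m i l :
  in_Psi k th -> alloc m = alloc (truthful hk th) ->
  (forall i, clarke_pay alloc m i = clarke_pay alloc (truthful hk th) i) ->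
  posbid (m i) (alloc m l) - posbid (m i) (alloc m i)
    <= th l (alloc m l) - th l (alloc m i).
Proof.
move=> thP eqs eqp.
(* At [m], [i] does not envy [l]; at the truthful profile, [l] does not envy [i]. In the sum the
   equal payments cancel. *)
have := clarke_pay_no_envy alloc m i l max_alloc; rewrite !eqp.
have := clarke_pay_no_envy alloc (truthful hk th) l i max_alloc.
by rewrite -eqs !posbid_truthful //; lra.
Qed.

Lemma winner_message (sg : {perm 'I_n}) i (L delta : R) :
  (sg i < k)%N -> 0 <= L -> 0 < delta ->
  exists x, [/\ Xh i x,
    (forall q : 'I_n, (sg i < q)%N -> posbid x q <= posbid x (sg i) - L) &
    (forall q : 'I_n, posbid x q <= posbid x (sg i) + delta)].
Proof.
move=> ik L0 d0; pose N : R := n%:R.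
have N0 : 0 < N by rewrite ltr0n (leq_ltn_trans _ (ltn_ord i)).
pose B := 2 * L + N; have B0 : 0 < B by rewrite /B; lra.
(* The first bound is what the step weights require; the second makes the flat part cost at most
   [delta] even for the largest [v], bounded by [B]. *)
pose eta := Num.min (1 / (4 * N)) (delta / (B * N)).
have eta0 : 0 < eta by rewrite lt_min !divr_gt0 ?mulr_gt0.
have eta1 : N * eta <= 1 / 4.
  have : eta <= 1 / (4 * N) by rewrite ge_min lexx.
  by rewrite ler_pdivlMr ?mulr_gt0 //; lra.
have eta2 : B * (N * eta) <= delta.
  have : eta <= delta / (B * N) by rewrite ge_min lexx orbT.
  by rewrite ler_pdivlMr ?mulr_gt0 // => le_d; rewrite mulrA mulrC.
pose beta := step_weight k (sg i) eta.
(* The base [2 * L] turns a weight drop of 1/2 into [L]; the rest decreases strictly along [sg] and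
   so forces [i] into [sg i]. *)
pose v (a : 'I_n) := 2 * L + (N - (sg a)%:R).
have v_lo a : 2 * L <= v a by rewrite lerDl subr_ge0 ler_nat ltnW.
have v_hi a : v a <= B by rewrite lerD2l gerBl.
have beta_ok : beta_ok k beta by exact: step_weight_ok.
have thP : in_Psi k (fun a p => beta p * v a).
  exists beta, v; split=> //.
  by split=> // a; apply: le_trans (v_lo a); rewrite mulr_ge0.
have [m [[Xm _] [eqs eqp]]] := HV _ thP.
have si : alloc m i = sg i.
  apply: val_inj; rewrite eqs.
  have eff := truthful_efficient hk _ alloc thP max_alloc.
  apply: (efficient_sorted _ beta v _ sg i beta_ok _ _ eff ik) => // a b ab.
  by rewrite ltrD2l ltrD2l ltrN2 ltr_nat.
have diff q := preserving_bid_diff _ m i (((alloc m)^-1)%g q) thP eqs eqp.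
have drop (q : 'I_n) : (sg i < q)%N -> posbid (m i) q <= posbid (m i) (sg i) - L.
  move=> iq; have := diff q; rewrite permKV si /= -mulrBl; set l := ((alloc m)^-1)%g q.
  have := step_weight_drop (sg i) eta ik eta0 eta1 q iq; rewrite -/beta => dr.
  suff: (beta q - beta (sg i)) * v l <= - L by lra.
  apply: le_trans (_ : - (1 / 2) * v l <= _); last by have := v_lo l; lra.
  by rewrite ler_wpM2r // (le_trans _ (v_lo l)) // mulr_ge0.
exists (m i); split=> // q; have [qi|iq] := leqP q (sg i); last first.
  by have := drop q iq; lra.
have := diff q; rewrite permKV si /= -mulrBl; set l := ((alloc m)^-1)%g q.
have := step_weight_flat (sg i) eta ik eta0 eta1 q qi; rewrite -/beta => fl.
suff: (beta q - beta (sg i)) * v l <= delta by lra.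
have vl0 : 0 <= v l by rewrite (le_trans _ (v_lo l)) // mulr_ge0.
apply: le_trans eta2; rewrite mulrC.
apply: le_trans (_ : v l * (N * eta) <= _); first by rewrite ler_wpM2l.
by rewrite ler_wpM2r // ltW // mulr_gt0.
Qed.

(** Scaling [th] down keeps efficiency and makes all payments tiny; agents of value 0 pay nothing.
    No-envy turns these prices into bounds on bids. *)
Lemma losing_messages (th : valuation R n) (delta : R) : in_Psi k th -> 0 < delta ->
  exists m : profile R n k, [/\ forall i, Xh i (m i), efficient th (alloc m) &
    forall i, th i (alloc m i) = 0 ->
      (forall q : 'I_n, posbid (m i) q <= posbid (m i) (alloc m i) + delta) /\
      (forall l, th l (alloc m l) = 0 ->
         posbid (m i) (alloc m l) <= posbid (m i) (alloc m i))].
Proof.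
move=> thP d0; pose S := \sum_(l < n) \sum_(p < n) th l p.
have S0 : 0 <= S by do 2!(apply: sumr_ge0 => ? _); apply: in_Psi_ge0 thP.
pose c := delta / (1 + S); have c0 : 0 < c by rewrite divr_gt0 //; lra.
have cS : c * S <= delta.
  by rewrite /c mulrAC ler_pdivrMr; [rewrite ler_wpM2l; lra | lra].
pose th' : valuation R n := fun i p => c * th i p.
have thP' : in_Psi k th' by apply: in_Psi_scale; rewrite // ltW.
have [m [[Xm _] [eqs eqp]]] := HV _ thP'.
have pb i p : posbid (truthful hk th' i) p = c * th i p by rewrite posbid_truthful.
have pb0 i (p : 'I_n) : 0 <= posbid (truthful hk th' i) p.
  by rewrite pb mulr_ge0 ?(ltW c0) ?(in_Psi_ge0 _ _ _ thP).
have pay_le i : clarke_pay alloc m i <= delta.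
  rewrite eqp; apply: clarke_pay_le => s; rewrite ler_wpDl ?sumr_ge0 //.
  apply: le_trans cS; rewrite /others_bid mulr_sumr [leRHS](bigD1 i) //=.
  rewrite ler_wpDl //.
    by rewrite mulr_ge0 ?(ltW c0) ?sumr_ge0 // => ? _; apply: in_Psi_ge0 thP.
  apply: ler_sum => l _; rewrite pb ler_wpM2l ?(ltW c0) //.
  by rewrite (bigD1 (s l)) //= lerDl sumr_ge0 // => ? _; apply: in_Psi_ge0 thP.
(* If [i] contributes nothing to the maximal total, the others already attain their own maximum. *)
have pay0 i : th i (alloc m i) = 0 -> clarke_pay alloc m i = 0.
  move=> thi; apply: le_anti; rewrite clarke_pay_ge0 andbT eqp.
  apply: clarke_pay_le => s; rewrite addr0.
  have := max_alloc (truthful hk th') s.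
  rewrite !(total_bid_others _ i) [X in _ <= X + _]pb -eqs thi mulr0 add0r.
  by apply: le_trans; rewrite lerDr.
have envy i l := clarke_pay_no_envy alloc m i l max_alloc.
exists m; split=> // [|i /pay0 pi].
  move=> s; have := truthful_efficient hk th' alloc thP' max_alloc s.
  by rewrite -eqs /th' -!mulr_sumr ler_pM2l.
split=> [q|l /pay0 pl].
  have := envy i (((alloc m)^-1)%g q); rewrite permKV pi.
  have := pay_le (((alloc m)^-1)%g q); lra.
by have := envy i l; rewrite pi pl; lra.
Qed.

End Messages.

(** * Equilibrium analysis of the combined profile *)

Lemma in_Psi_decreasing {R : realType} {n k : nat} (th : valuation R n) i (p q : 'I_n) :
  in_Psi k th -> 0 < th i p -> (p < q)%N -> th i q < th i p.
Proof.
case=> beta [v [[_ [bpos [bdec b0]]] [v0 thE]]]; rewrite !thE => thp pq.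
have vi : 0 < v i.
  rewrite lt_neqAle v0 andbT eq_sym; apply: contraTneq thp => ->.
  by rewrite mulr0 ltxx.
have bp : 0 < beta p by rewrite -(pmulr_lgt0 _ vi).
rewrite ltr_pM2r //; have [qk|/b0 -> //] := ltnP q k; exact: bdec.
Qed.

Lemma others_bid_update {R : realType} {n k : nat} (m : profile R n k) i x s :
  others_bid (update m i x) i s = others_bid m i s.
Proof. by apply: eq_bigr => l /negPf li; rewrite /update li. Qed.

(** The maximum ignores the message of [i], so a deviation changes its payment only through the
    induced assignment. *)
Lemma clarke_pay_update {R : realType} {n k : nat} alloc (m : profile R n k) i x :
  clarke_pay alloc (update m i x) i
    = clarke_pay alloc m i + others_bid m i (alloc m)
      - others_bid m i (alloc (update m i x)).
Proof.
rewrite /clarke_pay subrK !others_bid_update; congr (_ - _).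
by apply: eq_bigr => s _; rewrite others_bid_update.
Qed.

Section Pinned.
Context {R : realType} {n k : nat}.
Variables (alloc : profile R n k -> {perm 'I_n}) (Xh : 'I_n -> bid R k -> Prop).
Variables (th : valuation R n) (sg : {perm 'I_n}) (m : profile R n k) (L delta : R).
Hypotheses (max_alloc : maximizing_rule alloc) (thP : in_Psi k th).
Hypotheses (eff : efficient th sg) (delta_gt0 : 0 < delta).
Hypothesis L_large : forall i p, th i p + n%:R * delta < L.
Hypothesis bid_le : forall i (q : 'I_n), posbid (m i) q <= posbid (m i) (sg i) + delta.
Hypothesis win : forall i (q : 'I_n), 0 < th i (sg i) -> (sg i < q)%N ->
  posbid (m i) q <= posbid (m i) (sg i) - L.
Hypothesis lose : forall i l, th i (sg i) = 0 -> th l (sg l) = 0 ->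
  posbid (m i) (sg l) <= posbid (m i) (sg i).

Let W i := 0 < th i (sg i).

Let notW i : ~~ W i -> th i (sg i) = 0.
Proof.
by rewrite -leNgt => th0; apply: le_anti; rewrite th0 (in_Psi_ge0 _ _ _ thP).
Qed.

Lemma sum_posbid_le (P : pred 'I_n) (s : {perm 'I_n}) :
  \sum_(l | P l) posbid (m l) (s l)
    <= \sum_(l | P l) posbid (m l) (sg l) + n%:R * delta.
Proof.
apply: le_trans (_ : \sum_(l | P l) (posbid (m l) (sg l) + delta) <= _).
  exact: ler_sum.
rewrite big_split /= lerD2l sumr_const mulr_natl; apply: ler_wpMn2l; first exact: ltW.
by rewrite -[leqRHS]card_ord max_card.
Qed.

(** One winner moving down costs [L] in bids, while all other agents together gain at most
    [n%:R * delta]. *)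
Lemma winner_moves_down (P : pred 'I_n) (s : {perm 'I_n}) :
  (forall a, P a -> W a -> (s a <= sg a)%N) \/
  \sum_(l | P l) posbid (m l) (s l)
    <= \sum_(l | P l) posbid (m l) (sg l) - L + n%:R * delta.
Proof.
have [/existsP[a /and3P[Pa Wa sa]]|] := boolP [exists a, [&& P a, W a & (sg a < s a)%N]].
  right; rewrite (bigD1 a) //= [X in _ <= X - _ + _](bigD1 a) //=.
  have := sum_posbid_le (fun l => P l && (l != a)) s; have := win a _ Wa sa; lra.
rewrite negb_exists => /forallP down; left=> a Pa Wa; rewrite leqNgt.
by have := down a; rewrite Pa Wa.
Qed.

(** A winner cannot move up: better slots belong to winners, who by induction stay. The cutoff [j]
    serves the case where the winner at [j] itself deviates. *)
Lemma winners_pinned (s : {perm 'I_n}) j :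
  (forall a, W a -> (sg a < j)%N -> (s a <= sg a)%N) ->
  forall a, W a -> (sg a < j)%N -> s a = sg a.
Proof.
move=> down a; have [r] := ubnP (sg a); elim: r a => // r IH a.
rewrite ltnS => ar Wa aj; apply: val_inj; apply/eqP; rewrite eqn_leq down //=.
rewrite leqNgt; apply/negP => sa; pose b := (sg^-1)%g (s a).
have sgb : sg b = s a by rewrite permKV.
have Wb : W b by rewrite /W sgb; apply: winners_downset thP eff Wa sa.
have : s b = sg b by apply: IH; rewrite // sgb; [exact: leq_trans sa ar | exact: ltn_trans sa aj].
by rewrite sgb => /perm_inj e; move: sa; rewrite -sgb e ltnn.
Qed.

Lemma loser_position (s : {perm 'I_n}) i : (forall a, W a -> s a = sg a) ->
  ~~ W i -> th ((sg^-1)%g (s i)) (s i) = 0.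
Proof.
move=> pin Wi; pose l := (sg^-1)%g (s i); have sgl : sg l = s i by rewrite permKV.
have Wl : ~~ W l.
  by apply: contra Wi => Wl; move: (Wl); rewrite (perm_inj (etrans (pin l Wl) sgl)).
by have := notW l Wl; rewrite sgl.
Qed.

Lemma loser_bid_le (s : {perm 'I_n}) i : (forall a, W a -> s a = sg a) ->
  ~~ W i -> posbid (m i) (s i) <= posbid (m i) (sg i).
Proof.
move=> pin Wi; have th0 := loser_position s i pin Wi.
have := lose i ((sg^-1)%g (s i)) (notW i Wi); rewrite permKV; exact.
Qed.

Lemma alloc_pinned a : W a -> alloc m a = sg a.
Proof.
move=> Wa; have [down|] := winner_moves_down predT (alloc m).
  by apply: (winners_pinned (alloc m) n) => // b Wb _; apply: down.
move=> /(le_trans (max_alloc m sg)); rewrite -/(total_bid m sg) => le_sg.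
by exfalso; have := L_large a (sg a); move: Wa; rewrite /W; lra.
Qed.

(** Tie-breaking may permute the losers, so [alloc m] need not be [sg]; but no agent bids more for
    its new position, so maximality of the total passes to the others. *)
Lemma pinned_others_ge i : others_bid m i sg <= others_bid m i (alloc m).
Proof.
have := max_alloc m sg; rewrite !(total_bid_others m i).
suff : posbid (m i) (alloc m i) <= posbid (m i) (sg i) by lra.
have [Wi|Wi] := boolP (W i); first by rewrite alloc_pinned.
by apply: loser_bid_le => //; apply: alloc_pinned.
Qed.

Lemma loser_others (s : {perm 'I_n}) i : ~~ W i ->
  (forall a, W a -> s a = sg a) /\ others_bid m i s <= others_bid m i sg \/
  others_bid m i s <= others_bid m i sg - L + n%:R * delta.
Proof.
move=> Wi; have [down|le_o] := winner_moves_down (fun l => l != i) s; last by right.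
have pin a : W a -> s a = sg a.
  move=> Wa; apply: (winners_pinned s n) => // b Wb _; apply: down => //.
  by apply: contraNneq Wi => <-.
left; split=> //; apply: ler_sum => l _.
by have [Wl|Wl] := boolP (W l); [rewrite pin | apply: loser_bid_le].
Qed.

Lemma pinned_pay_le i : clarke_pay alloc m i <= n%:R * delta.
Proof.
apply: clarke_pay_le => s; have := sum_posbid_le (fun l => l != i) s.
have := pinned_others_ge i; rewrite /others_bid; lra.
Qed.

Lemma pinned_efficient : efficient th (alloc m).
Proof.
move=> s; apply: le_trans (eff s) _; apply: ler_sum => i _.
have [Wi|/notW->] := boolP (W i); first by rewrite alloc_pinned.
exact: in_Psi_ge0 thP.
Qed.

Hypothesis gap : forall i p q, th i p < th i q -> n%:R * delta <= th i q - th i p.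

(** Up to a constant, the VCG utility of [i] is its value plus the others' bids. Optimality over all
    assignments rules out every deviation, whatever the message sets. *)
Lemma pinned_optimal i (s : {perm 'I_n}) :
  th i (s i) + others_bid m i s <= th i (alloc m i) + others_bid m i (alloc m).
Proof.
have ge_sg := pinned_others_ge i; have L_i := L_large i (s i).
have th_s := in_Psi_ge0 _ i (s i) thP.
have th_a := in_Psi_ge0 _ i (alloc m i) thP.
have [Wi|Wi] := boolP (W i); last first.
  have [[pin le_o]|le_o] := loser_others s i Wi; last by lra.
  have th0 := loser_position s i pin Wi.
  (* With winners in place, [i] takes a loser's position; efficiency of [sg] under this swap makes
     it worth 0 to [i]. *)
  have := efficient_swap _ _ i ((sg^-1)%g (s i)) eff; rewrite permKV th0 notW //.
  by have := in_Psi_ge0 _ ((sg^-1)%g (s i)) (sg i) thP; lra.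
rewrite alloc_pinned //.
have [si|si|si] := ltngtP (s i) (sg i).
(* Moving up displaces the winner [b]. Were no other winner to move down, [b] would be pinned at
   [s i]; so some winner moves down and the others' bids fall by about [L]. *)
- have [down|] := winner_moves_down (fun l => l != i) s; last first.
    by move: ge_sg; rewrite /others_bid alloc_pinned // in th_a *; lra.
  pose b := (sg^-1)%g (s i); have sgb : sg b = s i by rewrite permKV.
  have Wb : W b by rewrite /W sgb; apply: winners_downset thP eff Wi si.
  have : s b = sg b.
    apply: (winners_pinned s (sg i)) => //; last by rewrite sgb.
    by move=> a Wa ai; apply: down => //; apply: contraTneq ai => ->; rewrite ltnn.
  by rewrite sgb => /perm_inj e; move: si; rewrite -sgb e ltnn.
(* Moving down loses at least [n%:R * delta] in value, as much as the others' bids can rise. *)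
- have := gap _ _ _ (in_Psi_decreasing _ _ _ _ thP Wi si).
  have := sum_posbid_le (fun l => l != i) s; move: ge_sg; rewrite /others_bid; lra.
- have := max_alloc m s; rewrite !(total_bid_others m i) alloc_pinned //.
  by rewrite (val_inj si); lra.
Qed.

Lemma pinned_NE : (forall i, Xh i (m i)) -> is_NE alloc Xh th m.
Proof.
move=> Xm; split=> // i x _; rewrite /utility clarke_pay_update.
have := pinned_optimal i (alloc (update m i x)); lra.
Qed.

End Pinned.

(** * Choice of constants and assembly *)

Lemma finite_pos_lower_bound {R : realType} {T : finType} (F : T -> R) :
  exists2 c : R, 0 < c & forall t, 0 < F t -> c <= F t.
Proof.
exists (\big[Num.min/1]_(t | 0 < F t) F t); first by apply: lt_bigmin.
by move=> t Ft; apply: bigmin_le_cond.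
Qed.

Theorem theorem3 (R : realType) (n k : nat) (hk : (k <= n)%N)
  (alloc : profile R n k -> {perm 'I_n})
  (Halloc : maximizing_rule alloc)
  (Xh : 'I_n -> bid R k -> Prop)
  (HV : vickrey_preserving hk alloc Xh) :
  forall th : valuation R n, in_Psi k th ->
  forall eps : R, 0 < eps ->
  exists m : profile R n k,
    is_NE alloc Xh th m /\ efficient th (alloc m) /\ revenue alloc m <= eps.
Proof.
move=> th thP eps eps0.
have th0 i p : 0 <= th i p by exact: in_Psi_ge0 thP.
have [c c0 cP] := finite_pos_lower_bound
  (fun t : 'I_n * 'I_n * 'I_n => th t.1.1 t.1.2 - th t.1.1 t.2).
pose N : R := n%:R; have N0 : 0 <= N by exact: ler0n.
(* [N * delta <= d <= c] stays below every positive value gap, and [N * d <= eps] bounds revenue;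
   [N + 1] avoids division by zero. *)
pose d := Num.min c (eps / (N + 1)); pose delta := d / (N + 1).
have d0 : 0 < d by rewrite lt_min c0 divr_gt0 //; lra.
have delta0 : 0 < delta by rewrite divr_gt0 //; lra.
have Nd : N * delta <= d.
  have : delta * (N + 1) = d by rewrite divfK // lt0r_neq0 //; lra.
  by lra.
have dc : d <= c by rewrite ge_min lexx.
have deps : N * d <= eps.
  have : d <= eps / (N + 1) by rewrite ge_min lexx orbT.
  by rewrite ler_pdivlMr; lra.
pose S := \sum_(i < n) \sum_(p < n) th i p.
pose L := S + N * delta + 1.
have thS i p : th i p <= S.
  rewrite /S (bigD1 i) //= (bigD1 p) //= -addrA lerDl addr_ge0 ?sumr_ge0 //.
  by move=> ? _; apply: sumr_ge0.
have L0 : 0 <= L.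
  have : 0 <= S by do 2!apply: sumr_ge0 => ? _.
  have : 0 <= N * delta by rewrite mulr_ge0 // ltW.
  by rewrite /L; lra.
have [m0 [Xm0 eff lose]] := losing_messages hk alloc Halloc Xh HV th delta thP delta0.
(* Ties may make [sg] differ from the assignment chosen for truthful [th]; its efficiency for [th]
   suffices, and the winners' messages are built for this [sg]. *)
set sg := alloc m0 in eff lose.
have choose i : exists x : bid R k, [/\ Xh i x,
    (forall q : 'I_n, posbid x q <= posbid x (sg i) + delta),
    (forall q : 'I_n, 0 < th i (sg i) -> (sg i < q)%N ->
       posbid x q <= posbid x (sg i) - L) &
    (forall l, th i (sg i) = 0 -> th l (sg l) = 0 ->
       posbid x (sg l) <= posbid x (sg i))].
  have [Wi|] := boolP (0 < th i (sg i)).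
    have ik : (sg i < k)%N.
      rewrite ltnNge; apply/negP => ki; case: thP Wi => beta [v [[_ [_ [_ b0]]] [_ ->]]].
      by rewrite b0 // mul0r ltxx.
    have [x [Xx drop flat]] := winner_message hk alloc Halloc Xh HV sg i L delta ik L0 delta0.
    by exists x; split=> // [q _|l e]; [exact: drop | rewrite e ltxx in Wi].
  rewrite -leNgt => le0; have e : th i (sg i) = 0 by apply: le_anti; rewrite le0 th0.
  have [le_d le_l] := lose i e.
  by exists (m0 i); split=> // l _; exact: le_l.
have [m mP] := fin_all_exists choose.
have L_large i p : th i p + N * delta < L by rewrite /L; have := thS i p; lra.
have bid_le i (q : 'I_n) : posbid (m i) q <= posbid (m i) (sg i) + delta.
  by have [_] := mP i.
have win i (q : 'I_n) : 0 < th i (sg i) -> (sg i < q)%N ->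
    posbid (m i) q <= posbid (m i) (sg i) - L by have [_ _ + _] := mP i; apply.
have lose' i l : th i (sg i) = 0 -> th l (sg l) = 0 ->
    posbid (m i) (sg l) <= posbid (m i) (sg i) by have [_ _ _] := mP i; apply.
exists m; split; [|split].
- apply: (pinned_NE alloc Xh th sg m L delta) => // [i p q pq|i]; last by have [] := mP i.
  apply: le_trans Nd _; apply: le_trans dc _.
  by apply: (cP (i, q, p)); rewrite subr_gt0.
- exact: (pinned_efficient alloc th sg m L delta).
- apply: le_trans deps; apply: le_trans (_ : \sum_(i < n) d <= _).
    apply: ler_sum => i _; apply: le_trans Nd.
    exact: (pinned_pay_le alloc th sg m L delta).
  by rewrite sumr_const card_ord mulr_natl.
Qed.
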